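(* There exists a positive constant $b_c$ such that for all configurations $\mathbf{q}$ and all $\mathbf{v}=[v_w\ \dot\delta_f\ \dot\delta_r]^{\mathrm T}\in\mathbb{R}^3$, $$\|\tilde{\mathbf{C}}(\mathbf{q},\dot{\mathbf{q}})\mathbf{v}\|\le b_c\|\mathbf{v}\|^2.$$ Moreover, on the operating set where $\delta_f,\delta_r\in D_\delta$ and $|\dot\delta_f|,|\dot\delta_r|\le\dot\delta_{\max}$, the matrix $\tilde{\mathbf{C}}$ is uniformly bounded: there is a constant $c_c$ such that $$\|\tilde{\mathbf{C}}(\mathbf{q},\dot{\mathbf{q}})\|\le c_c .$$
   Context: $\|\cdot\|$ is the Euclidean norm on vectors and the induced $2$-norm on matrices. Parameters $m,I,a,b>0$ and $A=\frac{a}{2(a^2+b^2)}$. The configuration is $\mathbf{q}=[x\ y\ \theta\ \varphi\ \delta_f\ \delta_r]^{\mathrm T}\in\mathbb{R}^6$, and the last two components of $\dot{\mathbf{q}}$ are $\dot\delta_f,\dot\delta_r$, the same as the last two components of the reduced velocity $\mathbf{v}$. $D_\delta\subset\mathbb{R}$ is a given compact set of steering angles and $\dot\delta_{\max}>0$ a given bound. The reduced Coriolis matrix is $\tilde{\mathbf{C}}(\mathbf{q},\dot{\mathbf{q}})=\mathrm{diag}(\tilde C_{11},0,0)$ with $$\tilde C_{11}=IA^2(\sin\delta_f-\sin\delta_r)(\cos\delta_f\,\dot\delta_f-\cos\delta_r\,\dot\delta_r)-\frac m4\sin(\delta_f-\delta_r)(\dot\delta_f-\dot\delta_r).$$ 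*)

(* Defs.v *)
From mathcomp Require Import all_boot all_order all_algebra.
From mathcomp Require Import all_classical all_reals all_analysis.

Set Implicit Arguments.
Unset Strict Implicit.
Unset Printing Implicit Defensive.

Import Order.TTheory GRing.Theory Num.Theory.
Import numFieldNormedType.Exports.

Local Open Scope classical_set_scope.
Local Open Scope ring_scope.

(* The library's norm on real matrices (notation `|x|) is the max norm, hence
   the Euclidean norm and its induced matrix norm are defined here. *)
Definition norm2 (R : realType) (n : nat) (x : 'cV[R]_n) : R :=
  Num.sqrt (\sum_(i < n) x i 0 ^+ 2).

Definition mxnorm2 (R : realType) (m n : nat) (M : 'M[R]_(m, n)) : R :=
  sup [set norm2 (M *m x) | x in [set x : 'cV[R]_n | norm2 x <= 1]].

(* [sup] has a default value on sets without a supremum; this never occurs. *)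
Lemma has_sup_mxnorm2 (R : realType) (m n : nat) (M : 'M[R]_(m, n)) :
  has_sup [set norm2 (M *m x) | x in [set x : 'cV[R]_n | norm2 x <= 1]].
Proof.
split.
  exists (norm2 (M *m 0)), 0 => //=.
  by rewrite /norm2 big1 ?sqrtr0 // => i _; rewrite mxE expr0n.
exists (Num.sqrt (\sum_i (\sum_j `|M i j|) ^+ 2)) => _ [x /= x1 <-].
apply: ler_wsqrtr; apply: ler_sum => i _.
rewrite -real_normK ?num_real //.
apply: lerXn2r; rewrite ?nnegrE ?normr_ge0 ?sumr_ge0 //.
rewrite mxE (le_trans (ler_norm_sum _ _ _)) //.
apply: ler_sum => j _; rewrite normrM ler_piMr //.
rewrite -sqrtr_sqr; apply: le_trans x1; apply: ler_wsqrtr.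
by rewrite (bigD1 j) //= lerDl sumr_ge0 // => k _; rewrite sqr_ge0.
Qed.

(* Components are indexed from 0: q = [x y theta phi delta_f delta_r]^T. *)
Definition delta_f (R : realType) (q : 'cV[R]_6) : R := q 4 0.
Definition delta_r (R : realType) (q : 'cV[R]_6) : R := q 5 0.

Definition A_coef (R : realType) (a b : R) : R := a / (2 * (a ^+ 2 + b ^+ 2)).

(* Applied to the velocity dq, [delta_f] and [delta_r] are the steering rates. *)
Definition C11 (R : realType) (m I a b : R) (q dq : 'cV[R]_6) : R :=
  I * A_coef a b ^+ 2 * (sin (delta_f q) - sin (delta_r q))
    * (cos (delta_f q) * delta_f dq - cos (delta_r q) * delta_r dq)
  - m / 4 * sin (delta_f q - delta_r q) * (delta_f dq - delta_r dq).

Definition Ctilde (R : realType) (m I a b : R) (q dq : 'cV[R]_6) : 'M[R]_3 :=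
  diag_mx (\row_j [:: C11 m I a b q dq; 0; 0]`_j).

(* Main.v *)
Require Import Defs.
From mathcomp Require Import all_boot all_order all_algebra.
From mathcomp Require Import all_classical all_reals all_analysis.

Import Order.TTheory GRing.Theory Num.Theory.
Import numFieldNormedType.Exports.

Local Open Scope classical_set_scope.
Local Open Scope ring_scope.

(** Only the top-left entry of [Ctilde] can be nonzero, so [Ctilde] sends [v] to a vector of norm
    [|C11| * |v 0 0|] ([norm2_Ctilde_mul]). As sine and cosine are bounded by 1, [C11_le] bounds
    [|C11|] by [K = 2 I A^2 + m/4] times the sum of the absolute steering rates, uniformly in [q].
    These rates are components of [v], hence at most [norm2 v], which makes the product quadratic in
    [norm2 v]; on the operating set they are at most [ddmax], which bounds the induced norm. *)

Lemma C11_le {R : realType} {m I : R} (a b : R) (q dq : 'cV[R]_6) :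
  0 < m -> 0 < I ->
  `|C11 m I a b q dq| <=
    (2 * I * A_coef a b ^+ 2 + m / 4) * (`|delta_f dq| + `|delta_r dq|).
Proof.
move=> m_gt0 I_gt0.
have sin_le1 (x : R) : `|sin x| <= 1 by rewrite ler_norml sin_geN1 sin_le1.
have cos_le1 (x : R) : `|cos x| <= 1 by rewrite ler_norml cos_geN1 cos_le1.
have IA_ge0 : 0 <= I * A_coef a b ^+ 2 by rewrite mulr_ge0 ?sqr_ge0 // ltW.
have m4_ge0 : 0 <= m / 4 by rewrite divr_ge0 // ltW.
apply: (le_trans (ler_normB _ _)); rewrite mulrDl; apply: lerD.
  (* The 2 in the constant is the bound on the difference of the two sines; it is moved last to
     match the factors of [C11]. *)
  rewrite -(mulrA 2) (mulrC 2) normrM; apply: ler_pM => //.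
    rewrite normrM ger0_norm // ler_wpM2l //.
    by apply: (le_trans (ler_normB _ _)); apply: lerD.
  apply: (le_trans (ler_normB _ _)); rewrite !normrM.
  by apply: lerD; rewrite ler_piMl.
rewrite normrM; apply: ler_pM => //; last exact: ler_normB.
by rewrite normrM ger0_norm // ler_piMr.
Qed.

Lemma norm2_Ctilde_mul (R : realType) (m I a b : R) (q dq : 'cV[R]_6)
    (v : 'cV[R]_3) :
  norm2 (Ctilde m I a b q dq *m v) = `|C11 m I a b q dq| * `|v 0 0|.
Proof.
rewrite /norm2 /Ctilde mul_diag_mx !big_ord_recl big_ord0 !mxE /=.
by rewrite !mul0r expr0n /= !addr0 sqrtr_sqr normrM.
Qed.

Lemma normr_le_norm2 {R : realType} {n : nat} (v : 'cV[R]_n) (i : 'I_n) :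
  `|v i 0| <= norm2 v.
Proof.
rewrite -sqrtr_sqr; apply: ler_wsqrtr.
by rewrite (bigD1 i) //= lerDl sumr_ge0 // => k _; rewrite sqr_ge0.
Qed.

Theorem mainTheorem6 (R : realType) (m I a b : R)
    (m_gt0 : 0 < m) (I_gt0 : 0 < I) (a_gt0 : 0 < a) (b_gt0 : 0 < b)
    (D : set R) (D_compact : compact D) (ddmax : R) (ddmax_gt0 : 0 < ddmax) :
  (exists2 b_c : R, 0 < b_c &
     forall (q dq : 'cV[R]_6) (v : 'cV[R]_3),
       delta_f dq = v 1 0 -> delta_r dq = v 2 0 ->
       norm2 (Ctilde m I a b q dq *m v) <= b_c * norm2 v ^+ 2) /\
  (exists c_c : R,
     forall q dq : 'cV[R]_6,
       D (delta_f q) -> D (delta_r q) ->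
       `|delta_f dq| <= ddmax -> `|delta_r dq| <= ddmax ->
       mxnorm2 (Ctilde m I a b q dq) <= c_c).
Proof.
set K := 2 * I * A_coef a b ^+ 2 + m / 4.
have K_gt0 : 0 < K.
  by rewrite ltr_wpDl ?divr_gt0 // mulr_ge0 ?sqr_ge0 // mulr_ge0 // ltW.
split.
  (* Each of the two rates contributes one [K * norm2 v]; the second factor [norm2 v] comes from
     [v 0 0]. *)
  exists (K * 2) => [|q dq v vf vr]; first by rewrite mulr_gt0.
  rewrite norm2_Ctilde_mul expr2 mulrA; apply: ler_pM => //.
    apply: (le_trans (C11_le a b q dq m_gt0 I_gt0)).
    rewrite vf vr -/K -mulrA ler_pM2l // mulrDl mul1r.
    by apply: lerD; apply: normr_le_norm2.
  exact: normr_le_norm2.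
exists (K * (ddmax + ddmax)) => q dq _ _ df_le dr_le.
(* The supremum of a nonempty set is below any upper bound, so it is enough to bound the image of
   each vector of the unit ball. *)
apply: ge_sup.
  by case: (has_sup_mxnorm2 (Ctilde m I a b q dq)).
(* The factor 1 added on the right bounds [|x 0 0|], since [norm2 x <= 1]. *)
move=> _ [x /= x_le1 <-]; rewrite norm2_Ctilde_mul -[leRHS]mulr1.
apply: ler_pM => //; last exact: le_trans (normr_le_norm2 _ _) x_le1.
apply: (le_trans (C11_le a b q dq m_gt0 I_gt0)).
by rewrite -/K ler_pM2l // lerD.
Qed.
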